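(* Let $d\ge 1$ be an integer and let $\Phi:\mathbb N\to[2,+\infty)$ be any function. Then the Lebesgue measure of $\Lambda_d(\Phi)$ satisfies $$\mathcal L(\Lambda_d(\Phi))=\begin{cases}0 & \text{if } \sum_{n=1}^\infty \frac{\log^{d-1}\Phi(n)}{\Phi(n)}<\infty,\\[1ex] 1 & \text{if } \sum_{n=1}^\infty \frac{\log^{d-1}\Phi(n)}{\Phi(n)}=\infty.\end{cases}$$
   Context: Every irrational $x\in[0,1)$ has a unique infinite continued fraction expansion $x=[a_1(x),a_2(x),\dots]=\cfrac{1}{a_1(x)+\cfrac{1}{a_2(x)+\cdots}}$ with partial quotients $a_n(x)\in\mathbb N$. For an integer $d\ge1$ and $\Phi:\mathbb N\to[2,\infty)$ define $$\Lambda_d(\Phi)=\{x\in[0,1)\setminus\mathbb Q:\ a_n(x)a_{2n}(x)\cdots a_{dn}(x)\ge \Phi(n)\text{ for infinitely many } n\in\mathbb N\}.$$ $\mathcal L$ denotes Lebesgue measure. *)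

(* Defs.v *)
From HB Require Import structures.
From mathcomp Require Import all_boot all_order all_algebra.
From mathcomp Require Import all_classical all_reals all_analysis.
Set Implicit Arguments. Unset Strict Implicit. Unset Printing Implicit Defensive.
Import Order.TTheory GRing.Theory Num.Theory.
Local Open Scope ring_scope.
Local Open Scope classical_set_scope.

Section CF.
Variable R : realType.

Definition gauss (y : R) : R := y^-1 - (Num.truncn (y^-1))%:R.

(* k-th partial quotient (k >= 1): a_k(x) = floor(1 / T^{k-1}(x)). *)
Definition cf_a (k : nat) (x : R) : nat := Num.truncn ((iter k.-1 gauss x)^-1).

Definition irrational (x : R) : Prop := ~ exists q : rat, x = ratr q.

Definition Lambda (d : nat) (Phi : nat -> R) : set R :=
  [set x | 0 <= x < 1 /\ irrational x /\
     forall N : nat, exists n : nat, (N < n)%N /\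
       Phi n <= (\prod_(1 <= i < d.+1) cf_a (i * n) x)%:R].
End CF.

(* Main.v *)
(** For [E] determined by a_1, ..., a_k, the explicit length of cylinders gives
    [P(E)/b <= P(E, a_(k+1) >= b) <= 2 P(E)/b]; nothing else about continued
    fractions is used.  With [lg j] the integer part of the base 4 logarithm of
    a_j, the product a_n a_2n ... a_dn is comparable to 4 to the power
    [lg n + lg 2n + ... + lg dn], and counting the decompositions of [s] into [d]
    summands shows that this sum is [>= s] with conditional probability of order
    (s+1)^(d-1) 4^(-s), which is of order log^(d-1) Phi / Phi when Phi is of
    order 4^s.  The convergence half is then the Borel-Cantelli lemma.

    For the divergence half, the events at [n] and [m] have joint probability
    at most a constant times the product of their weights unless [i n = j m] for
    some [i, j <= d], which for a given [n] happens for at most [d^2] values of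
    [m].  A second moment estimate, uniform over the past, therefore shows that
    after any index [k] there is a finite block of [n] in which, whatever
    a_1, ..., a_k are, some event occurs with conditional probability at least
    a fixed [delta > 0].  Iterating over successive blocks, almost surely infinitely many
    events occur. *)
Require Import Defs.
From HB Require Import structures.
From mathcomp Require Import all_boot all_order all_algebra.
From mathcomp Require Import all_classical all_reals all_analysis.
From mathcomp Require Import zify ring lra.
Import Order.TTheory GRing.Theory Num.Theory.
Local Open Scope ring_scope.
Local Open Scope classical_set_scope.
Set Implicit Arguments. Unset Strict Implicit. Unset Printing Implicit Defensive.

(** * Cylinders of continued fractions and their lengths *)

Section ContinuedFractions.
Variable R : realType.
Implicit Types (x y u : R) (w : seq nat) (E : set R).
Local Notation mu := (@lebesgue_measure R).

Definition Omega : set R := [set x | 0 <= x < 1 /\ Defs.irrational x].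

Lemma irrational_inv x : Defs.irrational x -> Defs.irrational x^-1.
Proof.
by rewrite /Defs.irrational => xI [q xq]; apply: xI; exists q^-1; rewrite fmorphV /= -xq invrK.
Qed.

Lemma irrational_subn x (n : nat) : Defs.irrational x -> Defs.irrational (x - n%:R).
Proof.
rewrite /Defs.irrational => xI [q xq]; apply: xI; exists (q + n%:R).
by rewrite rmorphD /= -xq ratr_nat subrK.
Qed.

Lemma irrational_neq_nat x (n : nat) : Defs.irrational x -> x != n%:R.
Proof.
by rewrite /Defs.irrational => xI; apply/eqP => xn; apply: xI; exists n%:R; rewrite ratr_nat.
Qed.

Lemma Omega_gt0 x : Omega x -> 0 < x.
Proof.
move=> [/andP[x0 _] /(irrational_neq_nat 0)/= xn].
by rewrite lt_neqAle eq_sym xn.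
Qed.

Lemma Omega_lt1 x : Omega x -> x < 1.
Proof. by move=> [/andP[]]. Qed.

Lemma gauss_Omega x : Omega x -> Omega (gauss x).
Proof.
move=> Ox; have x0 := Omega_gt0 Ox; have [_ xI] := Ox.
have xV0 : 0 <= x^-1 by rewrite invr_ge0 ltW.
split; last by apply: irrational_subn; apply: irrational_inv.
have /andP[le lt] := truncn_itv xV0.
by rewrite /gauss subr_ge0 le /= ltrBlDr -natr1 addrC in lt *.
Qed.

Lemma iter_gauss_Omega k x : Omega x -> Omega (iter k (@gauss R) x).
Proof. by move=> Ox; elim: k => //= k; exact: gauss_Omega. Qed.

Lemma cf_a_ge k x (b : nat) : (0 < k)%N -> Omega x ->
  (b <= cf_a k x)%N = (b%:R <= (iter k.-1 (@gauss R) x)^-1).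
Proof.
move=> k0 Ox; have y0 := Omega_gt0 (iter_gauss_Omega k.-1 Ox).
by rewrite /cf_a truncn_ge_nat // invr_ge0 ltW.
Qed.

Lemma cf_a_gt0 k x : (0 < k)%N -> Omega x -> (0 < cf_a k x)%N.
Proof.
move=> k0 Ox; rewrite cf_a_ge //.
have Oy := iter_gauss_Omega k.-1 Ox.
by rewrite invf_ge1 ?Omega_gt0 // ltW // Omega_lt1.
Qed.

Definition cf_word k x : seq nat := [seq cf_a i x | i <- iota 1 k].

Lemma size_cf_word k x : size (cf_word k x) = k.
Proof. by rewrite size_map size_iota. Qed.

Lemma cf_wordS k x : cf_word k.+1 x = cf_a 1 x :: cf_word k (gauss x).
Proof.
rewrite /cf_word /=; congr (_ :: _).
rewrite (iotaDl 1 1) -map_comp; apply/eq_in_map => i /=.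
by rewrite mem_iota => /andP[i1 _]; case: i i1 => // i _; rewrite /cf_a /= -iterSr.
Qed.

Lemma eq_cf_word k x y : cf_word k x = cf_word k y <->
  forall i, (1 <= i <= k)%N -> cf_a i x = cf_a i y.
Proof.
split => [/eq_in_map H i /andP[i1 ik]|H].
  by apply: H; rewrite mem_iota i1 add1n ltnS.
by apply/eq_in_map => i; rewrite mem_iota add1n ltnS; exact: H.
Qed.

(** The parameter [u] covers two cases at once: [u = 1] gives the whole cylinder of [w], and
    [u = 1/b] adds the condition that the next partial quotient is at least [b]. *)
Definition cylinder w u : set R :=
  [set x | [/\ Omega x, cf_word (size w) x = w
                 & iter (size w) (@gauss R) x <= u]].

Lemma cylinder_cons a w u x : cylinder (a :: w) u x <->
  [/\ Omega x, cf_a 1 x = a & cylinder w u (gauss x)].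
Proof.
rewrite /cylinder /= cf_wordS -iterS iterSr; split.
  by move=> [Ox [<- <-] xu]; split=> //; split=> //; [exact: gauss_Omega|rewrite size_cf_word].
by move=> [Ox -> [Oy -> yu]].
Qed.

(** The endpoints are unordered because each inverse branch [y -> 1/(a + y)] of the Gauss map is
    decreasing, so every further letter swaps them. *)
Definition between (a b x : R) := a <= x <= b \/ b <= x <= a.

Lemma between_inv (a : nat) (s t x : R) : (0 < a)%N -> 0 < x -> 0 <= s -> 0 <= t ->
  between (a%:R + s)^-1 (a%:R + t)^-1 x <-> between s t (x^-1 - a%:R).
Proof.
move=> a0 x0 s0 t0.
have A0 : 0 < a%:R :> R by rewrite ltr0n.
have H (r : R) : 0 <= r -> ((a%:R + r)^-1 <= x) = (x^-1 - a%:R <= r).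
  move=> r0; rewrite invf_ple ?posrE ?ltr_pwDl //.
  by rewrite lerBlDr addrC.
have H' (r : R) : 0 <= r -> (x <= (a%:R + r)^-1) = (r <= x^-1 - a%:R).
  move=> r0; rewrite invf_pge ?posrE ?ltr_pwDl //.
  by rewrite lerBrDr addrC.
rewrite /between !H // !H' //.
by split; case=> /andP[h1 h2]; [right|left|right|left]; rewrite h1 h2.
Qed.

(* [p, p', q, q'] are the convergents p_k, p_{k-1}, q_k, q_{k-1} of the word [w]. *)
Lemma cylinder_interval w : (forall u, cylinder w u = set0) \/
  exists p p' q q' : R,
    [/\ [/\ 0 <= p, 0 <= p', p <= q & p + p' <= q + q'], 0 < q, 0 <= q' <= q,
        q' + p' <= q + p &
        forall u, 0 <= u <= 1 -> cylinder w u =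
          [set x | Omega x /\ between (p / q) ((p + u * p') / (q + u * q')) x]].
Proof.
elim: w => [|a w [w0|[p [p' [q [q' [[p0 p'0 pq pq1] q0 /andP[q'0 q'q] qp H]]]]]]].
- right; exists 0, 1, 1, 0; split=> //.
    by split; rewrite ?ler01 // add0r addr0.
    by rewrite lexx ler01.
    by rewrite add0r addr0.
  move=> u /andP[u0 u1]; apply/seteqP; split=> x /=.
    move=> [Ox _ xu]; split=> //; left.
    rewrite mul0r mulr0 addr0 add0r mulr1 divr1 xu andbT.
    by rewrite ltW // Omega_gt0.
  rewrite mul0r mulr0 addr0 add0r mulr1 divr1.
  move=> [Ox [/andP[x0 xu]|/andP[ux x0]]]; split=> //.
  by have := Omega_gt0 Ox; rewrite ltNge x0.
- left=> u; apply/seteqP; split=> // x /cylinder_cons[_ _].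
  by rewrite w0.
(* Partial quotients on [Omega] are positive, so a word containing 0 has an empty cylinder. *)
have [->|a0] := posnP a.
  left=> u; apply/seteqP; split=> // x /cylinder_cons[Ox x0].
  by have := cf_a_gt0 (ltn0Sn 0) Ox; rewrite x0.
have A1 : 1 <= a%:R :> R by rewrite ler1n.
(* Prepending [a] replaces a fraction [r] by [1/(a + r)], so [p/q] becomes [q/(a q + p)], and
   likewise for [p'/q']. *)
right; exists q, q', (a%:R * q + p), (a%:R * q' + p').
have aq : q <= a%:R * q by rewrite ler_peMl // ltW.
have aq' : q' <= a%:R * q' by rewrite ler_peMl.
(* For [a = 1] this is the invariant [q' + p' <= q + p], carried through the induction for this
   purpose; larger [a] adds a multiple of [q' <= q]. *)
have aqq : a%:R * q' + p' <= a%:R * q + p.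
  have : (a%:R - 1) * q' <= (a%:R - 1) * q by rewrite ler_wpM2l // subr_ge0.
  by lra.
split.
- by split; lra.
- by lra.
- by apply/andP; split=> //; lra.
- by lra.
move=> u /andP[u0 u1].
have up : 0 <= u * p' by rewrite mulr_ge0.
have uq : 0 <= u * q' by rewrite mulr_ge0.
have Q0 : 0 < q + u * q' by lra.
have pq0 : 0 <= p / q by rewrite divr_ge0 // ltW.
have pqu0 : 0 <= (p + u * p') / (q + u * q') by apply: divr_ge0; lra.
have pq_1 : p / q <= 1 by rewrite ler_pdivrMr // mul1r.
have pqu1 : (p + u * p') / (q + u * q') <= 1.
  rewrite ler_pdivrMr // mul1r.
  have : u * (p + p') <= u * (q + q') by rewrite ler_wpM2l.
  have : (1 - u) * p <= (1 - u) * q by rewrite ler_wpM2l // subr_ge0.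
  by lra.
have -> : q / (a%:R * q + p) = (a%:R + p / q)^-1.
  by rewrite -{2}[a%:R](mulfK (lt0r_neq0 q0)) -mulrDl invf_div.
have -> : (q + u * q') / (a%:R * q + p + u * (a%:R * q' + p')) =
          (a%:R + (p + u * p') / (q + u * q'))^-1.
  rewrite -{3}[a%:R](mulfK (lt0r_neq0 Q0)) -mulrDl invf_div.
  by congr (_ / _); ring.
apply/seteqP; split=> x.
  move=> /cylinder_cons[Ox ax]; rewrite H ?u0 //= => -[_ B]; split=> //.
  apply/between_inv => //; first exact: Omega_gt0.
  by move: B; rewrite /gauss -ax.
move=> /= [Ox]; have x0 := Omega_gt0 Ox; have [_ xI] := Ox.
move=> /between_inv => /(_ a0 x0 pq0 pqu0) B.
(* Irrationality excludes the endpoint 1 of the range of [x^-1 - a], which makes [a] the integer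
   part of [x^-1]. *)
have yI : Defs.irrational (x^-1 - a%:R).
  by apply: irrational_subn; apply: irrational_inv.
have /andP[y0 y1] : 0 <= x^-1 - a%:R <= 1.
  by case: B => /andP[B1 B2]; apply/andP; split; lra.
have {}y1 : x^-1 - a%:R < 1.
  by rewrite lt_neqAle y1 andbT; exact: (irrational_neq_nat 1).
have ax : Num.truncn x^-1 = a.
  by apply: truncn_def; rewrite -natr1; apply/andP; split; lra.
apply/cylinder_cons; split=> //.
rewrite H ?u0 //= /gauss ax; split=> //.
by split=> //; rewrite y0 y1.
Qed.

Lemma Omega_interval (a b : R) : 0 <= a -> a <= b -> b <= 1 ->
  measurable [set x | Omega x /\ a <= x <= b] /\
  mu [set x | Omega x /\ a <= x <= b] = (b - a)%:E.
Proof.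
move=> a0 ab b1.
have -> : [set x | Omega x /\ a <= x <= b] = `[a, b] `\` range ratr.
  apply/seteqP; split=> x /=; rewrite in_itv /=.
    by move=> [[_ +] ->] => xI; split=> // -[q _ qx]; case: xI; exists q.
  move=> [xab xI]; have {}xI : Defs.irrational x.
    by move=> [q xq]; apply: xI; exists q.
  have /andP[ax xb] := xab; split=> //; split=> //.
  rewrite (le_trans a0) //= lt_neqAle (le_trans xb) // andbT.
  exact: (irrational_neq_nat 1).
have mQ : measurable (range (@ratr R) : set R).
  apply: countable_measurable; first by move=> t; exact: measurable_set1.
  by apply: (sub_countable (card_image_le _ _)); exact: countableP.
split; first exact: measurableD.
have <- : mu `[a, b] = (b - a)%:E.
  rewrite lebesgue_measure_itv /= lte_fin.
  by case: ltgtP ab => // -> _; rewrite subrr.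
have := measureDI mu (measurable_itv `[a, b]%R) mQ.
rewrite (@subset_measure0 _ _ _ mu (`[a, b] `&` range ratr) (range ratr)) //.
- by rewrite adde0 => <-.
- exact: measurableI.
- exact: lebesgue_measure_rat.
Qed.

(** Subtract the endpoints found in [cylinder_interval]. The factor [A] is the absolute determinant
    [|p' q - p q'|], or 0 for an empty cylinder; it is the same for all [u], so it cancels when two
    values of [u] are compared. *)
Lemma cylinder_measure w : exists A q q' : R,
  [/\ 0 <= A, 0 < q, 0 <= q' <= q & forall u, 0 <= u <= 1 ->
    measurable (cylinder w u) /\
    mu (cylinder w u) = (A * u / (q * (q + u * q')))%:E].
Proof.
have [w0|] := cylinder_interval w.
  exists 0, 1, 0; split=> //; first by rewrite lexx ler01.
  by move=> u _; rewrite w0 measure0 !mul0r.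
move=> [p [p' [q [q' [[p0 p'0 pq pq1] q0 /andP[q'0 q'q] qp H]]]]].
exists `|p' * q - p * q'|, q, q'; split=> //; first by rewrite q'0.
move=> u u01; have /andP[u0 u1] := u01; rewrite H //.
have up : 0 <= u * p' by rewrite mulr_ge0.
have uq : 0 <= u * q' by rewrite mulr_ge0.
have Q0 : 0 < q + u * q' by lra.
have s0 : 0 <= p / q by rewrite divr_ge0 // ltW.
have t0 : 0 <= (p + u * p') / (q + u * q') by apply: divr_ge0; lra.
have s1 : p / q <= 1 by rewrite ler_pdivrMr // mul1r.
have t1 : (p + u * p') / (q + u * q') <= 1.
  rewrite ler_pdivrMr // mul1r.
  have : u * (p + p') <= u * (q + q') by rewrite ler_wpM2l.
  have : (1 - u) * p <= (1 - u) * q by rewrite ler_wpM2l // subr_ge0.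
  by lra.
have -> : `|p' * q - p * q'| * u / (q * (q + u * q')) =
   `|(p + u * p') / (q + u * q') - p / q|.
  have -> : (p + u * p') / (q + u * q') - p / q =
    (p' * q - p * q') * (u / (q * (q + u * q'))).
    by field; rewrite !gt_eqF.
  by rewrite normrM [in RHS](@ger0_norm _ (u / _)) ?mulrA //
     divr_ge0 // ltW // mulr_gt0.
move: s0 s1 t0 t1; set s := p / q; set t := (_ / _) => s0 s1 t0 t1.
have [st|ts] := leP s t.
  have -> : [set x | Omega x /\ between s t x] = [set x | Omega x /\ s <= x <= t].
    apply/seteqP; split=> x /= [Ox]; last by split=> //; left.
    by move=> B; split=> //; case: B => // /andP[tx xs]; apply/andP; split; lra.
  rewrite ger0_norm ?subr_ge0 //; exact: Omega_interval.
have -> : [set x | Omega x /\ between s t x] = [set x | Omega x /\ t <= x <= s].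
  apply/seteqP; split=> x /= [Ox]; last by split=> //; right.
  by move=> B; split=> //; case: B => // /andP[tx xs]; apply/andP; split; lra.
rewrite distrC ger0_norm ?subr_ge0 ?(ltW ts) //; exact: Omega_interval (ltW ts) _.
Qed.

End ContinuedFractions.

(** * Events determined by finitely many partial quotients *)

Section Events.
Variable R : realType.
Implicit Types (x y u : R) (w : seq nat) (E F G : set R).
Local Notation mu := (@lebesgue_measure R).
Local Notation Omega := (@Omega R).

(** A pointwise form of membership in the sigma-algebra generated by a_1, ..., a_k: since there are
    countably many words of length [k], such a set is a countable union of cylinders. *)
Definition adapted k E := E `<=` Omega /\ forall x y, Omega y ->
  (forall i, (1 <= i <= k)%N -> cf_a i x = cf_a i y) -> E x -> E y.

Lemma adapted_le k k' E : (k <= k')%N -> adapted k E -> adapted k' E.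
Proof.
move=> kk' [EO Ek]; split=> // x y Oy xy; apply: Ek => // i /andP[i1 ik].
by apply: xy; rewrite i1 (leq_trans ik).
Qed.

Lemma adaptedT k : adapted k Omega.
Proof. by split. Qed.

Lemma adapted_cap k E (Q : set R) : adapted k E ->
  (forall x y, (forall i, (1 <= i <= k)%N -> cf_a i x = cf_a i y) -> Q x -> Q y) ->
  adapted k (E `&` Q).
Proof.
move=> [EO Ek] HQ; split; first by move=> x [/EO].
by move=> x y Oy xy [Ex Qx]; split; [exact: Ek Ex|exact: HQ Qx].
Qed.

(** The points of [E] are sorted by their word of length [k], coded as a natural number. A nonempty
    class is a full cylinder, because [E] depends on the word only. *)
Lemma adapted_decomp k E : adapted k E -> exists F : nat -> set R,
  [/\ trivIset setT F, E = \bigcup_i F i &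
      forall i, F i = set0 \/ exists2 w, size w = k & F i = cylinder w 1].
Proof.
move=> [EO Ek]; exists (fun i => [set x | E x /\ pickle (cf_word k x) = i]); split.
- by move=> i j _ _ [x [[_ <-] [_ <-]]].
- apply/seteqP; split=> [x Ex|x [i _ []//]].
  by exists (pickle (cf_word k x)).
move=> i; have [->|/set0P[x [Ex xi]]] :=
    eqVneq [set x | E x /\ pickle (cf_word k x) = i] set0; first by left.
right; exists (cf_word k x); first exact: size_cf_word.
apply/seteqP; split=> y /=; rewrite /cylinder /= size_cf_word.
  move=> [Ey yi]; have Oy := EO _ Ey; split=> //.
    by apply: (pcan_inj pickleK); rewrite xi yi.
  by rewrite ltW // Omega_lt1 //; exact: iter_gauss_Omega.
move=> [Oy yx _]; rewrite yx; split=> //.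
by apply: Ek Ex => //; apply/eq_cf_word.
Qed.

(** The next partial quotient is the integer part of the inverse of the current Gauss iterate, so it
    is at least [b] exactly when that iterate is at most [1/b]. *)
Lemma cylinder_cap w (b : nat) : (0 < b)%N ->
  cylinder w 1 `&` [set x : R | (b <= cf_a (size w).+1 x)%N] = cylinder w b%:R^-1.
Proof.
move=> b0; apply/seteqP; split=> x.
  move=> [[Ox xw _]] /=; rewrite cf_a_ge //= => bx; split=> //.
  rewrite invf_pge ?posrE ?ltr0n //.
  exact: Omega_gt0 (iter_gauss_Omega _ Ox).
move=> [Ox xw xb]; split.
  by split=> //; apply: le_trans xb _; rewrite invf_le1 ?ltr0n // ler1n.
rewrite /= cf_a_ge //= -invf_pge ?posrE ?ltr0n //.
exact: Omega_gt0 (iter_gauss_Omega _ Ox).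
Qed.

Lemma measurable_adapted k E : adapted k E -> measurable E.
Proof.
move=> /adapted_decomp[F [_ -> HF]]; apply: bigcupT_measurable => i.
case: (HF i) => [->|[w _ ->]]; first exact: measurable0.
have [A [q [q' [_ _ _ H]]]] := cylinder_measure R w.
by apply: (H 1 _).1; rewrite ler01 lexx.
Qed.

(* The only quantitative input about continued fractions. *)
Lemma mu_adapted_cf_a_ge k E (b : nat) : adapted k E -> (0 < b)%N ->
  (mu (E `&` [set x | (b <= cf_a k.+1 x)%N]) <= (2 / b%:R)%:E * mu E)%E /\
  ((b%:R^-1)%:E * mu E <= mu (E `&` [set x | (b <= cf_a k.+1 x)%N]))%E.
Proof.
move=> /adapted_decomp[F [tF -> HF]] b0.
set B := [set x | _].
have B0 : 0 < b%:R :> R by rewrite ltr0n.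
have b1 : 1 <= b%:R :> R by rewrite ler1n.
have bV01 : 0 <= (b%:R : R)^-1 <= 1 by rewrite invr_ge0 (ltW B0) invf_le1.
have mF i : measurable (F i).
  case: (HF i) => [->|[w _ ->]]; first exact: measurable0.
  have [A [q [q' [_ _ _ H]]]] := cylinder_measure R w.
  by apply: (H 1 _).1; rewrite ler01 lexx.
have FB i : measurable (F i `&` B) /\
  (mu (F i `&` B) <= (2 / b%:R)%:E * mu (F i))%E /\
  ((b%:R^-1)%:E * mu (F i) <= mu (F i `&` B))%E.
  case: (HF i) => [->|[w wk ->]]; first by rewrite set0I measure0 !mule0.
  have [A [q [q' [A0 q0 /andP[q'0 q'q] H]]]] := cylinder_measure R w.
  rewrite /B -wk cylinder_cap //.
  have [mC ->] := H _ bV01; split=> //.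
  have [|_ ->] := H 1; first by rewrite ler01 lexx.
  have Aq : 0 <= A / q by rewrite divr_ge0 // ltW.
  (* The two lengths have ratio [(q + q')/(b q + q')], which lies between [1/b] and [2/b] because
     [0 <= q' <= q]. *)
  have -> : A * b%:R^-1 / (q * (q + b%:R^-1 * q')) = A / q * (b%:R * q + q')^-1.
    by field; rewrite !gt_eqF //; nra.
  have -> : A * 1 / (q * (q + 1 * q')) = A / q * (q + q')^-1.
    by field; rewrite !gt_eqF //; nra.
  have qq : 0 < q + q' by lra.
  have bqq : 0 < b%:R * q + q' by nra.
  have bqq' : 0 < b%:R * (q + q') by rewrite mulr_gt0.
  rewrite -!EFinM !lee_fin; split.
    have -> : 2 / b%:R * (A / q * (q + q')^-1) = A / q * (2 / (b%:R * (q + q'))).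
      by field; rewrite !gt_eqF.
    by apply: ler_wpM2l => //; rewrite ler_pdivlMr // mulrC ler_pdivrMr //; nra.
  have -> : b%:R^-1 * (A / q * (q + q')^-1) = A / q * (b%:R * (q + q'))^-1.
    by field; rewrite !gt_eqF.
  apply: ler_wpM2l => //; rewrite lef_pV2 ?posrE //.
  by nra.
rewrite setI_bigcupl !measure_bigcup //; last 3 first.
- by move=> i _; exact: mF.
- by move=> i _; have [] := FB i.
- exact: trivIset_setIr.
split.
  rewrite -nneseriesZl //; apply: lee_nneseries => // i _.
  by have [_ []] := FB i.
rewrite -nneseriesZl //; apply: lee_nneseries => i _.
  by move=> _; rewrite mule_ge0 // lee_fin invr_ge0 ltW.
by have [_ []] := FB i.
Qed.

End Events.

(** * Elementary probability on [Omega] *)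

Section Probability.
Variable R : realType.
Implicit Types (x y : R) (E F G : set R) (k K n s : nat).
Local Notation mu := (@lebesgue_measure R).
Local Notation Omega := (@Omega R).

Definition prob E : R := fine (mu E).
Local Notation P := prob.

Definition event E := measurable E /\ E `<=` Omega.

Lemma mu_Omega : mu Omega = 1%E.
Proof.
have [_] := @Omega_interval R 0 1 (lexx _) ler01 (lexx _).
rewrite subr0 => <-; congr (mu _); apply/seteqP; split=> x /=; last by case.
by move=> Ox; split=> //; rewrite (ltW (Omega_gt0 Ox)) (ltW (Omega_lt1 Ox)).
Qed.

Lemma event_Omega : event Omega.
Proof. by split=> //; exact: measurable_adapted (adaptedT R 0). Qed.

Lemma adapted_event k E : adapted k E -> event E.
Proof. by move=> aE; split; [exact: measurable_adapted aE|exact: aE.1]. Qed.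

Lemma eventI E F : event E -> measurable F -> event (E `&` F).
Proof. by move=> [mE EO] mF; split; [exact: measurableI|move=> x [/EO]]. Qed.

Lemma eventU E F : event E -> event F -> event (E `|` F).
Proof.
move=> [mE EO] [mF FO]; split; first exact: measurableU.
by move=> x [/EO|/FO].
Qed.

Lemma eventD E F : event E -> measurable (E `&` F) -> event (E `\` F).
Proof.
move=> [mE EO] mF; split; last by move=> x [/EO].
by rewrite -[E `\` F]set0U -(setDv E) -setDIr; exact: measurableD.
Qed.

Lemma mu_prob E : event E -> mu E = (P E)%:E.
Proof.
move=> [mE EO]; rewrite /prob fineK //.
rewrite ge0_fin_numE ?measure_ge0 //.
apply: (@le_lt_trans _ _ (mu Omega)).
  by apply: le_measure => //; rewrite inE //; exact: event_Omega.1.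
by rewrite mu_Omega ltry.
Qed.

Lemma prob_ge0 E : 0 <= P E.
Proof. by rewrite fine_ge0 ?measure_ge0. Qed.

Lemma prob_le E F : event E -> event F -> E `<=` F -> P E <= P F.
Proof.
move=> eE eF EF; rewrite -lee_fin -!mu_prob //.
by apply: le_measure => //; rewrite inE; [exact: eE.1|exact: eF.1].
Qed.

Lemma prob_split E F : event E -> measurable (E `&` F) ->
  P E = P (E `&` F) + P (E `\` F).
Proof.
move=> eE mF; apply: EFin_inj; rewrite EFinD -!mu_prob //.
- rewrite (measureDI mu eE.1 mF) setIA setIid addeC.
  by rewrite setDIr setDv set0U.
- exact: eventD.
- by split=> // x [/eE.2].
Qed.

Lemma prob_setU E F : event E -> event F -> P (E `|` F) <= P E + P F.
Proof.
move=> eE eF; rewrite -lee_fin EFinD -!mu_prob //; last exact: eventU.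
by apply: measureU2; [exact: eE.1|exact: eF.1].
Qed.

Lemma prob_set0 : P set0 = 0.
Proof. by rewrite /prob measure0. Qed.

Lemma prob_union E n (F : nat -> set R) : event E ->
  (forall i, (i < n)%N -> event (F i)) ->
  (forall x, E x -> exists2 i, (i < n)%N & F i x) ->
  P E <= \sum_(i < n) P (F i).
Proof.
elim: n E => [|n IHn] E eE eF EF.
  rewrite big_ord0 (_ : E = set0) ?prob_set0 //.
  by apply/seteqP; split=> // x /EF[].
have mFn : measurable (F n) by have [] := eF n (ltnSn n).
have mEF : measurable (E `&` F n) by apply: measurableI => //; exact: eE.1.
rewrite big_ord_recr /= addrC (prob_split eE mEF); apply: lerD.
  by apply: prob_le; [exact: eventI|exact: eF|exact: subIsetr].
apply: IHn; first exact: eventD.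
  by move=> i ltin; apply: eF; exact: ltnW.
move=> x [/EF[i]]; rewrite ltnS leq_eqVlt => /predU1P[-> //|ltin Fi _].
by exists i.
Qed.

Lemma prob_disjoint_sum E n (F : nat -> set R) : event E ->
  (forall i, (i < n)%N -> event (F i)) ->
  (forall i x, (i < n)%N -> F i x -> E x) ->
  (forall i j x, F i x -> F j x -> i = j) ->
  \sum_(i < n) P (F i) <= P E.
Proof.
elim: n E => [|n IHn] E eE eF FE dF; first by rewrite big_ord0 prob_ge0.
have mFn : measurable (F n) by have [] := eF n (ltnSn n).
have mEF : measurable (E `&` F n) by apply: measurableI => //; exact: eE.1.
rewrite big_ord_recr /= addrC (prob_split eE mEF); apply: lerD.
  apply: prob_le; [exact: eF|exact: eventI|].
  by move=> x Fx; split=> //; exact: FE Fx.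
apply: IHn => //; first exact: eventD.
  by move=> i ltin; apply: eF; exact: ltnW.
move=> i x ltin Fi; split; first by apply: FE Fi; exact: ltnW.
by move=> Fn; rewrite (dF _ _ _ Fi Fn) ltnn in ltin.
Qed.

(** * Base 4 logarithms of single partial quotients *)

Definition lg j x := trunc_log 4 (cf_a j x).

Lemma lg_ge j m x : (0 < j)%N -> Omega x -> (m <= lg j x)%N = (4 ^ m <= cf_a j x)%N.
Proof.
move=> j0 Ox; rewrite /lg; apply/idP/idP => [mj|]; last exact: trunc_log_max.
apply: leq_trans (@trunc_logP 4 _ isT (cf_a_gt0 j0 Ox)).
by rewrite leq_exp2l.
Qed.

Lemma adapted_lg k E (Q : nat -> Prop) j : adapted k E -> (0 < j <= k)%N ->
  adapted k (E `&` [set x | Q (lg j x)]).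
Proof.
move=> aE jk; apply: adapted_cap => // x y xy; rewrite /lg /=.
by rewrite (xy _ jk).
Qed.

Lemma prob_cf_a_ge k E j (b : nat) : adapted k E -> (k < j)%N -> (0 < b)%N ->
  b%:R^-1 * P E <= P (E `&` [set x | (b <= cf_a j x)%N]) <= 2 / b%:R * P E.
Proof.
case: j => // j aE; rewrite ltnS => kj b0; have {}aE := adapted_le kj aE.
have eE := adapted_event aE.
have eEb : event (E `&` [set x | (b <= cf_a j.+1 x)%N]).
  apply: (@adapted_event j.+1); apply: adapted_cap; first exact: adapted_le aE.
  by move=> x y xy /=; rewrite (xy j.+1) //= ltnSn.
have [] := mu_adapted_cf_a_ge aE b0.
by rewrite !mu_prob // -!EFinM !lee_fin => -> ->.
Qed.

Lemma lg_setE E j m : E `<=` Omega -> (0 < j)%N ->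
  E `&` [set x | (m <= lg j x)%N] = E `&` [set x | (4 ^ m <= cf_a j x)%N].
Proof.
by move=> EO j0; apply/seteqP; split=> x [Ex] /= H; split=> //; move: H;
  rewrite lg_ge //; exact: EO.
Qed.

Lemma prob_lg_ge k E j m : adapted k E -> (k < j)%N ->
  P (E `&` [set x | (m <= lg j x)%N]) <= 2 * 4^-1 ^+ m * P E.
Proof.
move=> aE kj; rewrite lg_setE; [|exact: aE.1|exact: leq_ltn_trans kj].
have /andP[_] := @prob_cf_a_ge k E j (4 ^ m) aE kj (expn_gt0 _ _).
by rewrite natrX exprVn.
Qed.

(** Subtract the upper bound at [4 ^ m.+1] from the lower bound at [4 ^ m]: what remains is the
    fraction [1 - 2/4] of the latter. Base 4 is chosen for this; in base 2 the upper constant 2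
    would leave nothing. *)
Lemma prob_lg_eq k E j m : adapted k E -> (k < j)%N ->
  2^-1 * 4^-1 ^+ m * P E <= P (E `&` [set x | lg j x = m]).
Proof.
move=> aE kj; have j0 : (0 < j)%N by exact: leq_ltn_trans kj.
have aEj : adapted j E by apply: adapted_le aE; exact: ltnW.
have := @prob_cf_a_ge k E j (4 ^ m) aE kj (expn_gt0 _ _).
have := @prob_cf_a_ge k E j (4 ^ m.+1) aE kj (expn_gt0 _ _).
rewrite -!lg_setE //; [|exact: aE.1..].
rewrite !natrX -!exprVn => /andP[_ h2] /andP[h1 _].
have aEQ Q : event (E `&` [set x | Q (lg j x)]).
  by apply: (@adapted_event j); apply: (@adapted_lg _ _ Q) => //; rewrite j0 leqnn.
have : P (E `&` [set x | (m <= lg j x)%N]) <=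
    P (E `&` [set x | (m.+1 <= lg j x)%N]) + P (E `&` [set x | lg j x = m]).
  apply: le_trans (prob_setU (aEQ (fun v => (m.+1 <= v)%N)) (aEQ (fun v => v = m))).
  apply: prob_le; [exact: (aEQ (fun v => (m <= v)%N))| |].
    exact: (eventU (aEQ (fun v => (m.+1 <= v)%N)) (aEQ (fun v => v = m))).
  move=> x [Ex] /=; rewrite leq_eqVlt => /predU1P[mE|mlt]; first by right.
  by left.
move: h1 h2; rewrite exprS; have := prob_ge0 E; set c := _ ^+ m.
set p1 := prob _; set p2 := prob _; set p3 := prob _; set p4 := prob _.
by move=> *; lra.
Qed.

(** * Simultaneous lower bounds and sums of logarithms *)

Definition demand k K (m : nat -> nat) : set R :=
  [set x | forall j, (k < j <= K)%N -> (m j <= lg j x)%N].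

(* The value 1 at 0 makes unconstrained indices harmless in [demand_bound]. *)
Definition tail_bound (m : nat) : R := if m == 0%N then 1 else 2 * 4^-1 ^+ m.

Lemma tail_bound_ge0 m : 0 <= tail_bound m.
Proof.
by rewrite /tail_bound; case: ifP => // _; rewrite mulr_ge0 // exprn_ge0 // invr_ge0.
Qed.

Lemma tail_bound_le m : tail_bound m <= 2 * 4^-1 ^+ m.
Proof. by rewrite /tail_bound; case: eqP => // ->; rewrite expr0 mulr1 ler1n. Qed.

Definition demand_bound k K m : R := \prod_(k.+1 <= j < K.+1) tail_bound (m j).

Lemma demand_bound_ge0 k K m : 0 <= demand_bound k K m.
Proof. by apply: prodr_ge0 => j _; exact: tail_bound_ge0. Qed.

Lemma adapted_demand E k K m : adapted K E -> adapted K (E `&` demand k K m).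
Proof.
move=> aE; apply: adapted_cap => // x y xy H j /andP[kj jK].
rewrite /lg -xy; first by apply: H; rewrite kj.
by rewrite jK andbT; exact: leq_ltn_trans kj.
Qed.

(** The indices are treated in increasing order: the demands up to [K] form an event adapted to [K],
    so the demand at [K.+1] contributes its own conditional factor. *)
Lemma prob_demand k K E m : adapted k E -> (k <= K)%N ->
  P (E `&` demand k K m) <= demand_bound k K m * P E.
Proof.
move=> aE; elim: K => [|K IHK].
  rewrite leqn0 => /eqP k0; subst k.
  rewrite /demand_bound big_geq // mul1r; apply: prob_le.
  - by apply: (@adapted_event 0); exact: adapted_demand.
  - exact: adapted_event aE.
  - exact: subIsetl.
rewrite leq_eqVlt => /predU1P[kK|].
  subst k; rewrite /demand_bound big_geq // mul1r; apply: prob_le.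
  - by apply: (@adapted_event K.+1); exact: adapted_demand.
  - exact: adapted_event aE.
  - exact: subIsetl.
rewrite ltnS => kK; have {}IHK := IHK kK.
have aEK : adapted K E by exact: adapted_le aE.
have aEK1 : adapted K.+1 E by apply: adapted_le aE; exact: leqW.
have aED : adapted K (E `&` demand k K m) by exact: adapted_demand.
rewrite /demand_bound big_nat_recr //= -/(demand_bound k K m).
set D := E `&` demand k K.+1 m.
have eD : event D by apply: (@adapted_event K.+1); exact: adapted_demand.
have sD : D `<=` E `&` demand k K m `&` [set x | (m K.+1 <= lg K.+1 x)%N].
  move=> x [Ex Dx]; split; [split=> // j /andP[kj jK]|].
    by apply: Dx; rewrite kj leqW.
  by apply: Dx; rewrite ltnS kK leqnn.
have aED1 : adapted K.+1 (E `&` demand k K m) by exact: adapted_le aED.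
have [m0|mn0] := eqVneq (m K.+1) 0%N.
  rewrite /tail_bound m0 eqxx mulr1; apply: le_trans IHK.
  apply: prob_le => //; first exact: adapted_event aED.
  by apply: subset_trans sD _; exact: subIsetl.
rewrite /tail_bound (negbTE mn0) mulrAC [X in _ <= X]mulrC.
apply: le_trans (ler_wpM2l _ IHK); last by rewrite mulr_ge0 // exprn_ge0 // invr_ge0.
apply: le_trans (prob_lg_ge (m K.+1) aED (ltnSn K)).
apply: prob_le => //; apply: (@adapted_event K.+1).
by apply: (@adapted_lg _ _ (fun v => (m K.+1 <= v)%N)) => //=; rewrite leqnn.
Qed.

Definition upd (m : nat -> nat) j v := fun i => if i == j then v else m i.

Lemma demand_bound_upd k K m j v : (k < j <= K)%N -> m j = 0%N ->
  demand_bound k K (upd m j v) = tail_bound v * demand_bound k K m.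
Proof.
move=> kjK mj.
have jin : j \in index_iota k.+1 K.+1 by rewrite mem_index_iota.
rewrite /demand_bound (big_rem j) //= [in RHS](big_rem j) //=.
have -> : upd m j v j = v by rewrite /upd eqxx.
have -> : tail_bound (m j) = 1 by rewrite mj.
rewrite mul1r; congr (_ * _).
apply: eq_big_seq => i; rewrite (rem_filter _ (iota_uniq _ _)) mem_filter.
by rewrite /= /upd => /andP[/negbTE -> _].
Qed.

Definition lgsum (l : seq nat) x := (\sum_(j <- l) lg j x)%N.

(** The hypothesis says that [F] costs a factor [c] on top of any demands that leave the indices in
    [V] free. The conclusion has the same shape, with one more sum included in the event, so the
    lemma can be applied twice. Since demands are conditioned in increasing order once and for all
    in [prob_demand], the order of [l] and its interleaving with [V] do not matter. *)
Lemma prob_lgsum_ge k K F (V : seq nat) (c : R) :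
  adapted K F -> 0 <= c ->
  (forall m, (forall j, j \in V -> m j = 0%N) ->
    P (F `&` demand k K m) <= c * demand_bound k K m) ->
  forall l s m, (0 < size l)%N -> uniq l ->
  (forall j, j \in l -> (k < j <= K)%N /\ j \notin V) ->
  (forall j, j \in V ++ l -> m j = 0%N) ->
  P (F `&` [set x | (s <= lgsum l x)%N] `&` demand k K m) <=
  c * (2 ^+ size l * s.+1%:R ^+ (size l).-1 * 4^-1 ^+ s) * demand_bound k K m.
Proof.
move=> aF c0 HF; case=> // j0 l s m _; elim: l j0 s m => [|j' l IHl] j s m.
  move=> _ Hl Hm; have [jkK jV] := Hl j (mem_head _ _).
  have mj : m j = 0%N by apply: Hm; rewrite mem_cat mem_head orbT.
  (* A sum with a single term is just one more demand. *)
  apply: (@le_trans _ _ (P (F `&` demand k K (upd m j s)))).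
    apply: prob_le; [apply: (@adapted_event K)..|].
    - apply: adapted_demand; apply: adapted_cap => // x y xy.
      rewrite /= /lgsum !big_seq1 /lg xy //.
      by have /andP[kj ->] := jkK; rewrite andbT; exact: leq_ltn_trans kj.
    - exact: adapted_demand.
    move=> x [[Fx]]; rewrite /= /lgsum big_seq1 => sj Dx; split=> // i ikK.
    by rewrite /upd; case: eqP => [->//|_]; exact: Dx.
  apply: le_trans (HF _ _) _.
    move=> i iV; rewrite /upd; case: eqP => [ij|_].
      by rewrite -ij iV in jV.
    by apply: Hm; rewrite mem_cat iV.
  rewrite demand_bound_upd // mulrA; apply: ler_wpM2r; first exact: demand_bound_ge0.
  by apply: ler_wpM2l => //=; rewrite expr0 mulr1 expr1 tail_bound_le.
rewrite cons_uniq => /andP[jnl unl] Hl Hm.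
have [jkK jV] := Hl j (mem_head _ _).
have mj : m j = 0%N by apply: Hm; rewrite mem_cat mem_head orbT.
have Hl' i : i \in j' :: l -> (k < i <= K)%N /\ i \notin V.
  by move=> il; apply: Hl; rewrite inE il orbT.
have Kbound i : (k < i <= K)%N -> (0 < i <= K)%N.
  by move=> /andP[ki ->]; rewrite andbT; exact: leq_ltn_trans ki.
have aS t l' : (forall i, i \in l' -> (k < i <= K)%N) ->
    adapted K (F `&` [set x | (t <= lgsum l' x)%N]).
  move=> l'K; apply: adapted_cap => // x y xy /=.
  rewrite /lgsum (eq_big_seq (fun i => lg i y)) // => i /l'K/Kbound ib.
  by rewrite /lg xy.
set S := F `&` _ `&` _.
have eS : event S.
  apply: (@adapted_event K); apply: adapted_demand; apply: aS => i il.
  by have [] := Hl i il.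
(* Here [r] is the sum over the remaining indices, cut off at [s]; the missing [s - r] becomes a
   demand at [j]. *)
pose T r := F `&` [set x | (r <= lgsum (j' :: l) x)%N] `&`
  demand k K (upd m j (s - r)).
have eT r : event (T r).
  apply: (@adapted_event K); apply: adapted_demand; apply: aS => i il.
  by have [] := Hl' i il.
apply: (@le_trans _ _ (\sum_(r < s.+1) P (T r))).
  apply: prob_union => // x [[Fx]]; rewrite /= {1}/lgsum big_cons => sx Dx.
  exists (minn s (lgsum (j' :: l) x)); first by rewrite ltnS geq_minl.
  split; first by split=> //=; rewrite geq_minr.
  move=> i ikK; rewrite /upd; case: eqP => [->|_]; last exact: Dx.
  by move: sx; rewrite -/(lgsum (j' :: l) x); lia.
set B := c * _ * _.
(* The target is cut into [s.+1] equal shares, one for each [r]; this is where the power of [s.+1]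
   grows by one. *)
have -> : B = \sum_(r < s.+1) B / s.+1%:R.
  by rewrite sumr_const card_ord -[RHS]mulr_natr divfK // pnatr_eq0.
apply: ler_sum => -[r /=]; rewrite ltnS => rs _.
apply: le_trans (IHl j' r (upd m j (s - r)) unl Hl' _) _.
  move=> i il; rewrite /upd; case: eqP => [ij|_].
    by move: il; rewrite ij mem_cat (negbTE jV) (negbTE jnl).
  by apply: Hm; move: il; rewrite !mem_cat !inE => /orP[->//|->]; rewrite !orbT.
rewrite demand_bound_upd // /B /=.
set N := size l; set D := demand_bound k K m.
have D0 : 0 <= D by exact: demand_bound_ge0.
have s1 : s.+1%:R != 0 :> R by rewrite pnatr_eq0.
have -> : c * (2 ^+ N.+2 * s.+1%:R ^+ N.+1 * 4^-1 ^+ s) * D / s.+1%:R =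
  c * (2 ^+ N.+1 * s.+1%:R ^+ N * 4^-1 ^+ r) * (2 * 4^-1 ^+ (s - r) * D).
  have -> : 4^-1 ^+ s = 4^-1 ^+ (s - r) * 4^-1 ^+ r :> R by rewrite -exprD subnK.
  rewrite [s.+1%:R ^+ N.+1]exprS [2 ^+ N.+2]exprS.
  by move: (_ ^+ (s - r)) (_ ^+ r) (2 ^+ N.+1) (_ ^+ N) => *; field.
have q0 (t : nat) : 0 <= 4^-1 ^+ t :> R by rewrite exprn_ge0 // invr_ge0.
apply: ler_pM.
- by rewrite mulr_ge0 // mulr_ge0 // mulr_ge0 // exprn_ge0.
- by rewrite mulr_ge0 // tail_bound_ge0.
- apply: ler_wpM2l => //; apply: ler_wpM2r => //; apply: ler_wpM2l.
    by rewrite exprn_ge0.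
  by apply: lerXn2r; rewrite ?nnegrE // ler_nat ltnS.
- by apply: ler_wpM2r => //; exact: tail_bound_le.
Qed.

End Probability.

(** * Sums of logarithms over the multiples of an index *)

Section Products.
Variable R : realType.
Variable d : nat.
Hypothesis d0 : (0 < d)%N.
Implicit Types (x y : R) (E F G : set R) (k K n s : nat).
Local Notation mu := (@lebesgue_measure R).
Local Notation Omega := (@Omega R).
Local Notation P := (@prob R).

Definition multiples (e n : nat) := [seq (i * n)%N | i <- iota 1 e].

Lemma size_multiples e n : size (multiples e n) = e.
Proof. by rewrite size_map size_iota. Qed.

Lemma uniq_multiples e n : (0 < n)%N -> uniq (multiples e n).
Proof.
move=> n0; rewrite map_inj_uniq ?iota_uniq // => i j /eqP.
by rewrite eqn_pmul2r // => /eqP.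
Qed.

Lemma multiplesP e n j :
  reflect (exists2 i, (1 <= i <= e)%N & j = (i * n)%N) (j \in multiples e n).
Proof.
apply: (iffP mapP) => -[i ie ->]; exists i => //.
  by move: ie; rewrite mem_iota add1n ltnS.
by rewrite mem_iota add1n ltnS.
Qed.

Lemma multiples_bound e n k j : (k < n)%N -> j \in multiples e n ->
  (k < j <= e * n)%N.
Proof.
move=> kn /multiplesP[i /andP[i1 ie] ->]; rewrite leq_mul2r ie orbT andbT.
by apply: leq_trans kn _; rewrite leq_pmull.
Qed.

Lemma multiplesS e n : multiples e.+1 n = rcons (multiples e n) (e.+1 * n).
Proof. by have := iotaD 1 e 1; rewrite addn1 /multiples => ->; rewrite map_cat cats1. Qed.

Lemma lgsum_multiplesS e n x :
  lgsum (multiples e.+1 n) x = (lgsum (multiples e n) x + lg (e.+1 * n) x)%N.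
Proof. by rewrite multiplesS /lgsum -cats1 big_cat big_seq1. Qed.

Lemma lgsum_congr e n K x y : (0 < n)%N -> (e * n <= K)%N ->
  (forall i, (1 <= i <= K)%N -> cf_a i x = cf_a i y) ->
  lgsum (multiples e n) x = lgsum (multiples e n) y.
Proof.
move=> n0 enK xy; rewrite /lgsum; apply: eq_big_seq => j /(multiples_bound n0).
move=> /andP[j0 jn]; rewrite /lg xy // j0; exact: leq_trans jn enK.
Qed.

Definition weight s : R := s.+1%:R ^+ d.-1 * 4^-1 ^+ s.

Lemma weight_ge0 s : 0 <= weight s.
Proof. by rewrite mulr_ge0 // exprn_ge0 // invr_ge0. Qed.

Definition Bset n s : set R := Omega `&` [set x | (s <= lgsum (multiples d n) x)%N].

Lemma adapted_Bset n s K : (0 < n)%N -> (d * n <= K)%N -> adapted K (Bset n s).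
Proof.
move=> n0 nK; apply: adapted_cap; first exact: adaptedT.
by move=> x y xy /=; rewrite (lgsum_congr n0 nK xy).
Qed.

Lemma measurable_Bset n s : (0 < n)%N -> measurable (Bset n s).
Proof. by move=> n0; exact: (measurable_adapted (adapted_Bset s n0 (leqnn _))). Qed.

Lemma demand0 k K : demand k K (fun=> 0%N) = [set: R].
Proof. by apply/seteqP; split. Qed.

Lemma demand_bound0 k K : demand_bound R k K (fun=> 0%N) = 1.
Proof. by rewrite /demand_bound big1. Qed.

Lemma setI_Bset E n s : E `<=` Omega ->
  E `&` Bset n s = E `&` [set x | (s <= lgsum (multiples d n) x)%N].
Proof.
by move=> EO; apply/seteqP; split=> x [Ex]; [case|split=> //; split=> //; exact: EO].
Qed.

(** This is [prob_lgsum_ge] with [V] empty and no demands, where [prob_demand] provides the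
    hypothesis with [c = P E]. *)
Lemma prob_Bset_le k E n s : adapted k E -> (k < n)%N ->
  P (E `&` Bset n s) <= 2 ^+ d * weight s * P E.
Proof.
move=> aE kn; have kK : (k <= d * n)%N.
  by apply: leq_trans (ltnW kn) _; rewrite leq_pmull.
have := @prob_lgsum_ge R k (d * n) E [::] (P E) (adapted_le kK aE) (prob_ge0 _).
move=> /(_ _ (multiples d n) s (fun=> 0%N)).
rewrite demand0 setIT demand_bound0 mulr1 size_multiples setI_Bset; last exact: aE.1.
rewrite mulrC /weight mulrA; apply => //.
- by move=> m _; rewrite mulrC; exact: prob_demand.
- by apply: uniq_multiples; exact: leq_ltn_trans kn.
- by move=> j jn; split=> //; exact: multiples_bound jn.
Qed.

Definition related n n' :=
  has (fun i => has (fun j => (i * n == j * n')%N) (iota 1 d)) (iota 1 d).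

(** Two applications of [prob_lgsum_ge]: the first, with demands kept, supplies the hypothesis of
    the second, where [V] consists of the multiples of [n]. For unrelated [n] and [n'] the two sets
    of indices are disjoint, though they may interleave. *)
Lemma prob_Bset2_le k E n s n' s' : adapted k E -> (k < n)%N -> (k < n')%N ->
  ~~ related n n' ->
  P (E `&` Bset n s `&` Bset n' s') <=
  2 ^+ d * weight s * (2 ^+ d * weight s') * P E.
Proof.
move=> aE kn kn' nrel.
have n0 : (0 < n)%N by exact: leq_ltn_trans kn.
have n'0 : (0 < n')%N by exact: leq_ltn_trans kn'.
pose K := maxn (d * n) (d * n').
have nK : (d * n <= K)%N by exact: leq_maxl.
have n'K : (d * n' <= K)%N by exact: leq_maxr.
have kK : (k <= K)%N.
  by apply: leq_trans nK; apply: leq_trans (ltnW kn) _; rewrite leq_pmull.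
have aEK := adapted_le kK aE.
have aEB : adapted K (E `&` Bset n s).
  rewrite setI_Bset; last exact: aE.1.
  by apply: adapted_cap => // x y xy /=; rewrite (lgsum_congr n0 nK xy).
have H1 := @prob_lgsum_ge R k K E [::] (P E) aEK (prob_ge0 _).
have {H1} H1 m : (forall j, j \in multiples d n -> m j = 0%N) ->
    P (E `&` Bset n s `&` demand k K m) <=
    2 ^+ d * weight s * P E * demand_bound R k K m.
  move=> Hm; have := H1 _ (multiples d n) s m.
  rewrite size_multiples setI_Bset; last exact: aE.1.
  rewrite [P E * (_ * _)]mulrC /weight mulrA; apply => //.
  - by move=> m' _; rewrite mulrC; exact: prob_demand.
  - exact: uniq_multiples.
  - move=> j /(multiples_bound kn)/andP[-> jn]; split=> //=.
    exact: leq_trans jn nK.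
have c0 : 0 <= 2 ^+ d * weight s * P E.
  by rewrite mulr_ge0 ?prob_ge0 // mulr_ge0 ?weight_ge0 // exprn_ge0.
have := @prob_lgsum_ge R k K _ (multiples d n) _ aEB c0 H1 (multiples d n') s' (fun=> 0%N).
rewrite demand0 setIT demand_bound0 mulr1 size_multiples -setI_Bset; last first.
  by move=> x [/aE.1].
rewrite /weight -!mulrA [P E * _]mulrC -!mulrA; apply => //.
- exact: uniq_multiples.
- move=> j jn'; have /andP[-> jn] := multiples_bound kn' jn'; split=> /=.
    exact: leq_trans jn n'K.
  apply: contra nrel => /multiplesP[i id ij].
  have /multiplesP[i' i'd i'j] := jn'.
  apply/hasP; exists i; first by rewrite mem_iota add1n ltnS.
  by apply/hasP; exists i'; [rewrite mem_iota add1n ltnS|rewrite -ij -i'j].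
Qed.

(** It suffices to bound the event that the sum equals [s], since exact values give disjoint cases.
    The induction is on the number of multiples: the last one exceeds all the others, so the value
    [i] of its logarithm is controlled conditionally on the rest. *)
Lemma prob_Bset_ge : exists2 c : R, 0 < c & forall k E n s, adapted k E ->
  (k < n)%N -> c * weight s * P E <= P (E `&` Bset n s).
Proof.
suff [c c0 H] : exists2 c : R, 0 < c & forall k E n s, adapted k E -> (k < n)%N ->
    c * (s.+1%:R ^+ d.-1 * 4^-1 ^+ s) * P E <=
    P (E `&` [set x | lgsum (multiples d n) x = s]).
  exists c => // k E n s aE kn; apply: le_trans (H _ _ _ _ aE kn) _.
  have n0 : (0 < n)%N by exact: leq_ltn_trans kn.
  have kK : (k <= d * n)%N.
    by apply: leq_trans (ltnW kn) _; rewrite leq_pmull.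
  have aEK := adapted_le kK aE.
  rewrite setI_Bset; last exact: aE.1.
  apply: prob_le; [apply: (@adapted_event R (d * n))..|].
  - by apply: adapted_cap => // x y xy /=; rewrite (lgsum_congr n0 (leqnn _) xy).
  - by apply: adapted_cap => // x y xy /=; rewrite (lgsum_congr n0 (leqnn _) xy).
  - by move=> x [Ex /= <-].
have q0 (t : nat) : 0 <= 4^-1 ^+ t :> R by rewrite exprn_ge0 // invr_ge0.
case: d d0 => // e _ /=; elim: e => [|e [c c0 IHe]].
  exists 2^-1; first by rewrite invr_gt0.
  move=> k E n s aE kn; rewrite expr0 mul1r.
  apply: le_trans (prob_lg_eq s aE kn) _; rewrite le_eqVlt; apply/orP; left.
  apply/eqP; congr (P _); apply/seteqP; split=> x [Ex] /=;
    by rewrite /lgsum /multiples /= big_seq1 mul1n.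
(* Only [i <= s/2] is kept. One factor 1/2 comes from the number of such [i], at least [(s + 1)/2];
   one from [prob_lg_eq]; and [e] of them from [s - i + 1 >= (s + 1)/2], raised to the power [e]. *)
exists (c * 2^-1 * 2^-1 ^+ e.+1).
  by rewrite !mulr_gt0 ?exprn_gt0 ?invr_gt0.
move=> k E n s aE kn; have n0 : (0 < n)%N by exact: leq_ltn_trans kn.
pose F i := E `&` [set x | lgsum (multiples e.+1 n) x = (s - i)%N] `&`
  [set x | lg (e.+2 * n) x = i].
have kK : (k <= e.+1 * n)%N by apply: leq_trans (ltnW kn) _; rewrite leq_pmull.
have KK : (e.+1 * n < e.+2 * n)%N by rewrite ltn_pmul2r.
have aS r : adapted (e.+1 * n) (E `&` [set x | lgsum (multiples e.+1 n) x = r]).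
  apply: adapted_cap; first exact: adapted_le aE.
  by move=> x y xy /=; rewrite (lgsum_congr n0 (leqnn _) xy).
apply: (@le_trans _ _ (\sum_(i < s./2.+1) P (F i))); last first.
  apply: prob_disjoint_sum.
  - apply: (@adapted_event R (e.+2 * n)); apply: adapted_cap.
      by apply: adapted_le aE; exact: leq_trans (ltnW KK).
    by move=> x y xy /=; rewrite (lgsum_congr n0 (leqnn _) xy).
  - move=> i _; apply: (@adapted_event R (e.+2 * n)).
    apply: (@adapted_lg _ _ _ (fun v => v = i)).
      by apply: adapted_le (aS _); exact: ltnW.
    by rewrite leqnn andbT muln_gt0.
  - move=> i x; rewrite ltnS => i2 [[Ex /= xS] xi]; split=> //=.
    by rewrite lgsum_multiplesS xS xi; lia.
  - by move=> i j x [_ /= <-] [_ /= <-].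
pose B := c * 2^-1 ^+ e.+1 * (s.+1%:R ^+ e * 4^-1 ^+ s) * P E.
apply: (@le_trans _ _ (\sum_(i < s./2.+1) B)); last first.
  apply: ler_sum => -[i /=]; rewrite ltnS => i2 _.
  apply: le_trans (prob_lg_eq i (aS (s - i)%N) KK).
  apply: le_trans (ler_wpM2l _ (IHe _ _ _ (s - i)%N aE kn)); last first.
    by rewrite mulr_ge0 // invr_ge0.
  have is' : (i <= s)%N by lia.
  have -> : B = c * (2^-1 * 2^-1 ^+ e) *
      (s.+1%:R ^+ e * (4^-1 ^+ (s - i) * 4^-1 ^+ i)) * P E.
    by rewrite -exprD subnK // -exprS.
  set u := _ ^+ (s - i); set v := _ ^+ i.
  have -> : c * (2^-1 * 2^-1 ^+ e) * (s.+1%:R ^+ e * (u * v)) * P E =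
    (2^-1 * v * (c * u)) * P E * (2^-1 ^+ e * s.+1%:R ^+ e) by ring.
  have -> : 2^-1 * v * (c * ((s - i).+1%:R ^+ e * u) * P E) =
    (2^-1 * v * (c * u)) * P E * (s - i).+1%:R ^+ e by ring.
  apply: ler_wpM2l.
    apply: mulr_ge0; last exact: prob_ge0.
    by rewrite !mulr_ge0 ?invr_ge0 ?q0 // ltW.
  rewrite -exprMn; apply: lerXn2r; rewrite ?nnegrE ?mulr_ge0 ?invr_ge0 //.
  rewrite mulrC ler_pdivrMr // -natrM ler_nat.
  by move: i2 is'; lia.
rewrite sumr_const card_ord -[X in _ <= X]mulr_natr /B [s.+1%:R ^+ e.+1]exprS.
have -> : c * 2^-1 * 2^-1 ^+ e.+1 * (s.+1%:R * s.+1%:R ^+ e * 4^-1 ^+ s) * P E =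
  c * 2^-1 ^+ e.+1 * (s.+1%:R ^+ e * 4^-1 ^+ s) * P E * (s.+1%:R / 2).
  by field.
apply: ler_wpM2l.
  apply: mulr_ge0; last exact: prob_ge0.
  by rewrite !mulr_ge0 ?exprn_ge0 ?invr_ge0 ?q0 // ltW.
by rewrite ler_pdivrMr // -natrM ler_nat; lia.
Qed.

End Products.

(** * A second moment inequality for finitely many events *)

Section SecondMoment.
Variable R : realType.
Implicit Types (E F : set R) (A : nat -> set R) (J : seq nat).
Local Notation P := (@prob R).

(* The left-hand side is the integral over [E] of [(t - N)^2], where [N] counts
   the [n] in [J] such that [A n] occurs. *)
Lemma second_moment_ge0 A J E (t : R) : (forall n, n \in J -> measurable (A n)) ->
  event E ->
  0 <= t ^+ 2 * P E - 2 * t * \sum_(n <- J) P (E `&` A n) +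
       \sum_(n <- J) \sum_(m <- J) P (E `&` A n `&` A m).
Proof.
elim: J E t => [|a J IHJ] E t mA eE.
  by rewrite !big_nil mulr0 subr0 addr0 mulr_ge0 ?sqr_ge0 ?prob_ge0.
have mAa : measurable (A a) by apply: mA; rewrite mem_head.
have mAJ n : n \in J -> measurable (A n).
  by move=> nJ; apply: mA; rewrite inE nJ orbT.
have mEa : measurable (E `&` A a) by apply: measurableI => //; exact: eE.1.
have eE1 : event (E `&` A a) by exact: eventI.
have eE2 : event (E `\` A a) by exact: eventD.
have split1 F : measurable F ->
    P (E `&` F) = P (E `&` A a `&` F) + P ((E `\` A a) `&` F).
  move=> mF; rewrite (@prob_split R (E `&` F) (A a)) //.
  - by congr (P _ + P _); [rewrite setIAC|rewrite !setDE setIAC].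
  - exact: eventI.
  - by apply: measurableI => //; apply: measurableI => //; exact: eE.1.
have splitE := prob_split eE mEa.
rewrite !big_cons -[E `&` A a `&` A a]setIA setIid.
have -> : \sum_(n <- J) P (E `&` A n) = \sum_(n <- J) P (E `&` A a `&` A n) +
    \sum_(n <- J) P ((E `\` A a) `&` A n).
  by rewrite -big_split /=; apply: eq_big_seq => n nJ; exact: split1 (mAJ n nJ).
have -> : \sum_(n <- J) \sum_(m <- a :: J) P (E `&` A n `&` A m) =
    \sum_(n <- J) P (E `&` A a `&` A n) +
    (\sum_(n <- J) \sum_(m <- J) P (E `&` A a `&` A n `&` A m) +
     \sum_(n <- J) \sum_(m <- J) P ((E `\` A a) `&` A n `&` A m)).
  rewrite -!big_split /=; apply: eq_big_seq => n nJ.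
  rewrite big_cons setIAC; congr (_ + _).
  rewrite -big_split /=; apply: eq_big_seq => m mJ.
  by rewrite -!setIA split1 ?setIA //; apply: measurableI; exact: mAJ.
rewrite splitE.
(* On [A a] the count gains one, so the count over the rest of [J] is compared with [t - 1]; off
   [A a] it is compared with [t]. *)
have := IHJ _ (t - 1) mAJ eE1; have := IHJ _ t mAJ eE2.
move: (\sum_(n <- J) P (E `&` A a `&` A n)) (\sum_(n <- J) P ((E `\` A a) `&` A n)).
move: (\sum_(n <- J) \sum_(m <- J) P (E `&` A a `&` A n `&` A m)).
move: (\sum_(n <- J) \sum_(m <- J) P ((E `\` A a) `&` A n `&` A m)).
move: (P (E `&` A a)) (P (E `\` A a)) => p1 p2 Y2 Y1 X1 X2 h2 h1.
move: (addr_ge0 h1 h2); congr (0 <= _); ring.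
Qed.

(** Integrate the same square over the part of [E] covered by the [A n]: the two sums do not change,
    and only the [t ^+ 2] term sees the smaller set. Leaving [t] free takes the place of the
    Cauchy-Schwarz inequality. *)
Lemma second_moment A J E (t : R) : (forall n, n \in J -> event (A n)) -> event E ->
  event (E `&` \bigcup_(n in [set` J]) A n) /\
  2 * t * \sum_(n <- J) P (E `&` A n) -
    \sum_(n <- J) \sum_(m <- J) P (E `&` A n `&` A m) <=
  t ^+ 2 * P (E `&` \bigcup_(n in [set` J]) A n).
Proof.
move=> eA eE; set U := E `&` _.
have mA n : n \in J -> measurable (A n) by move=> /eA[].
have eU : event U.
  by apply: eventI => //; apply: bigcup_measurable => n /= nJ; exact: mA.
split=> //; have := second_moment_ge0 t mA eU.
have UA n : n \in J -> U `&` A n = E `&` A n.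
  move=> nJ; apply/seteqP; split=> x; first by case=> -[].
  by move=> [Ex An]; split=> //; split=> //; exists n.
have -> : \sum_(n <- J) P (U `&` A n) = \sum_(n <- J) P (E `&` A n).
  by apply: eq_big_seq => n nJ; rewrite UA.
have -> : \sum_(n <- J) \sum_(m <- J) P (U `&` A n `&` A m) =
    \sum_(n <- J) \sum_(m <- J) P (E `&` A n `&` A m).
  by apply: eq_big_seq => n nJ; apply: eq_big_seq => m mJ; rewrite UA.
by lra.
Qed.

End SecondMoment.

(** * Divergent weights: almost surely infinitely many events occur *)

Section Divergence.
Variable R : realType.
Variables (d : nat) (s : nat -> nat).
Hypothesis d0 : (0 < d)%N.
Local Notation P := (@prob R).
Local Notation w n := (weight R d (s n)).
Local Notation B n := (@Bset R d n (s n)).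
Hypothesis w_diverges : forall k (M : R), exists N, M <= \sum_(k.+1 <= n < N) w n.

(** A pair [(i, j)] with [i n = j m] determines [m] as a quotient, which leaves at most [d * d]
    candidates. *)
Lemma sum_related k N n :
  \sum_(k.+1 <= m < N) (related d n m)%:R <= (d ^ 2)%:R :> R.
Proof.
rewrite -natr_sum ler_nat.
apply: (@leq_trans (\sum_(k.+1 <= m < N) \sum_(i <- iota 1 d) \sum_(j <- iota 1 d)
    (m == (i * n) %/ j))).
  apply: leq_sum => m _.
  case rel: (related d n m) => //=.
  have /hasP[i iI /hasP[j jI /eqP ij]] := rel.
  have j0 : (0 < j)%N by move: jI; rewrite mem_iota => /andP[].
  rewrite (big_rem i) //= (big_rem j) //= ij mulKn // eqxx.
  by rewrite -addnA.
have sum_iota (f : nat -> nat) b : (forall i, f i <= b)%N ->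
    (\sum_(i <- iota 1 d) f i <= d * b)%N.
  move=> fb; apply: (@leq_trans (\sum_(i <- iota 1 d) b)); first exact: leq_sum.
  by rewrite big_const_seq count_predT size_iota iter_addn_0 mulnC.
rewrite exchange_big /= -mulnn; apply: (sum_iota _ d) => i.
rewrite exchange_big /= -[X in (_ <= X)%N]muln1; apply: sum_iota => j.
have -> : (\sum_(k.+1 <= m < N) (m == i * n %/ j) =
  count_mem (i * n %/ j) (index_iota k.+1 N))%N.
  by rewrite -sum1_count [RHS]big_mkcond.
by rewrite count_uniq_mem ?iota_uniq // leq_b1.
Qed.

(** The order of quantifiers is what the iteration over blocks relies on: [delta] is the same for
    all blocks, and the end [N] of a block does not depend on the past [E]. *)
Lemma prob_block_avoid : exists2 delta : R, 0 < delta & forall k, exists N, forall E, adapted k E ->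
  P (E `\` \bigcup_(n in [set` index_iota k.+1 N]) B n) <= (1 - delta) * P E.
Proof.
have [c c0 Hc] := @prob_Bset_ge R d d0.
pose C : R := 2 ^+ d.
have C1 : 1 <= C by rewrite exprn_ege1 // ler1n.
have C0 : 0 < C by lra.
(* This is [X^2 / (Y * P E)] for the lower bound [X = c * sg * P E] on the first moment and the
   upper bound [Y = 2 * C^2 * sg^2 * P E] on the second. *)
exists (c ^+ 2 / (2 * C ^+ 2)); first by rewrite divr_gt0 ?exprn_gt0 // mulr_gt0 ?exprn_gt0.
(* A total weight of at least [d ^ 2] ensures that the related pairs, at most [d ^ 2] for each [n],
   cost no more than the bound for the unrelated ones. *)
move=> k; have [N HN] := w_diverges k (d ^ 2)%:R; exists N => E aE.
pose J := index_iota k.+1 N; pose sg : R := \sum_(n <- J) w n.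
have kJ n : n \in J -> (k < n)%N by rewrite mem_index_iota => /andP[].
have eB n : n \in J -> event (B n).
  move=> /kJ kn; apply: (@adapted_event R (d * n)).
  by apply: adapted_Bset => //; exact: leq_ltn_trans kn.
have eE := adapted_event aE.
have p0 := prob_ge0 E.
have sg1 : (d ^ 2)%:R <= sg by [].
have sg0 : 0 < sg by apply: lt_le_trans sg1; rewrite ltr0n expn_gt0 d0.
have X : c * sg * P E <= \sum_(n <- J) P (E `&` B n).
  rewrite /sg big_distrr big_distrl /=; rewrite big_seq [X in _ <= X]big_seq; apply: ler_sum => n nJ.
  by apply: Hc aE _; exact: kJ.
have Y : \sum_(n <- J) \sum_(m <- J) P (E `&` B n `&` B m) <= 2 * C ^+ 2 * sg ^+ 2 * P E.
  apply: (@le_trans _ _ (\sum_(n <- J) (C * w n * P E * ((d ^ 2)%:R + C * sg)))).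
    rewrite big_seq [X in _ <= X]big_seq; apply: ler_sum => n nJ.
    apply: (@le_trans _ _ (\sum_(m <- J)
       (C * w n * P E * ((related d n m)%:R + C * w m)))).
      rewrite big_seq [X in _ <= X]big_seq; apply: ler_sum => m mJ; case: (boolP (related d n m)) => rel /=.
        (* For a related pair, [m = n] among them, the second event is dropped. *)
        apply: (@le_trans _ _ (P (E `&` B n))).
          apply: prob_le; last exact: subIsetl.
            by apply: eventI; [apply: eventI => //; exact: (eB n nJ).1|exact: (eB m mJ).1].
          by apply: eventI => //; exact: (eB n nJ).1.
        apply: le_trans (prob_Bset_le d0 (s n) aE (kJ _ nJ)) _.
        rewrite ler_peMr //; last by rewrite lerDl mulr_ge0 ?weight_ge0 // ltW.
        by rewrite !mulr_ge0 ?weight_ge0 // ltW.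
      rewrite add0r; apply: le_trans (prob_Bset2_le d0 _ _ aE (kJ _ nJ) (kJ _ mJ) rel) _.
      by rewrite le_eqVlt mulrAC eqxx.
    rewrite -big_distrr /= big_split /= -big_distrr /=; apply: ler_wpM2l.
      by rewrite !mulr_ge0 ?weight_ge0 // ltW.
    by apply: lerD => //; exact: sum_related.
  rewrite -big_distrl -!big_distrl -big_distrr /= -/sg.
  have : (d ^ 2)%:R <= C * sg by apply: le_trans sg1 _; rewrite ler_peMl // ltW.
  move=> h; have -> : 2 * C ^+ 2 * sg ^+ 2 * P E = C * sg * P E * (C * sg + C * sg) by ring.
  apply: ler_wpM2l; first by rewrite !mulr_ge0 // ltW.
  by rewrite lerD2r.
(* The value [t = Y / X] maximises [(2 t X - Y) / t^2] for the two moment bounds. *)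
pose t := 2 * C ^+ 2 / c * sg.
have t0 : 0 < t by rewrite mulr_gt0 // divr_gt0 // mulr_gt0 // exprn_gt0.
have [eU HU] := second_moment t eB eE.
rewrite -/J; move: eU HU; set U := bigcup _ _ => eU HU.
have mU : measurable (E `&` U) by exact: eU.1.
have := prob_split eE mU.
suff : c ^+ 2 / (2 * C ^+ 2) * P E <= P (E `&` U) by lra.
have t2 : 0 < t ^+ 2 by rewrite exprn_gt0.
rewrite -(ler_pM2l t2); apply: le_trans HU.
have : 2 * t * (c * sg * P E) <= 2 * t * \sum_(n <- J) P (E `&` B n).
  by apply: ler_wpM2l => //; rewrite mulr_ge0 // ltW.
move: Y; set Yv := (\sum_(n <- J) \sum_(m <- J) _).
set Xv := (\sum_(n <- J) _) => Yle Xle.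
have -> : t ^+ 2 * (c ^+ 2 / (2 * C ^+ 2) * P E) = 2 * C ^+ 2 * sg ^+ 2 * P E.
  by rewrite /t; field; rewrite !gt_eqF.
have E1 : 2 * t * (c * sg * P E) = 4 * C ^+ 2 * sg ^+ 2 * P E.
  by rewrite /t; field; rewrite gt_eqF.
by rewrite E1 in Xle; lra.
Qed.

(** The points avoiding every event beyond [N] lie in sets [E] of probability at most [q ^+ r], one
    for each [r], each obtained from the previous by removing the events of a new block. *)
Lemma avoid_null N :
  (@lebesgue_measure R) (@Omega R `\` \bigcup_(n in [set n | (N < n)%N]) B n) = 0%E.
Proof.
have [delta dl0 Hb] := prob_block_avoid.
(* The maximum with 0 makes [q] nonnegative without an upper bound on [delta]. *)
pose q := Num.max 0 (1 - delta).
have q0 : 0 <= q by rewrite le_max lexx.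
have q1 : q < 1 by rewrite gt_max ltr01 /=; lra.
have H r : exists k E, [/\ (N <= k)%N, adapted k E, P E <= q ^+ r &
    forall x, Omega x -> (forall n, (N < n)%N -> ~ B n x) -> E x].
  elim: r => [|r [k [E [Nk aE PE HE]]]].
    exists N, (@Omega R); split=> //; first exact: adaptedT.
    by rewrite expr0 /prob mu_Omega.
  have [M HM] := Hb k.
  (* The events of the block involve partial quotients of index up to at most [d * M], so the next
     block starts beyond that. *)
  pose K := maxn k (d * M).
  exists K, (E `\` \bigcup_(n in [set` index_iota k.+1 M]) B n); split.
  - by apply: leq_trans Nk _; exact: leq_maxl.
  - have aEK : adapted K E by apply: adapted_le aE; exact: leq_maxl.
    split; first by move=> x [/aE.1].
    move=> x y Oy xy [Ex nBx]; split; first exact: aEK.2 Ex.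
    move=> [n nJ Bny]; apply: nBx; exists n => //.
    have Ox := aE.1 _ Ex.
    move: nJ; rewrite /= mem_index_iota => /andP[kn nM].
    have aB : adapted K (B n).
      apply: adapted_Bset; first exact: leq_ltn_trans kn.
      by apply: leq_trans (leq_maxr _ _); rewrite leq_mul2l (ltnW nM) orbT.
    by apply: aB.2 Ox _ Bny => i iK; rewrite xy.
  - apply: le_trans (HM _ aE) _; rewrite exprS.
    apply: (@le_trans _ _ (q * P E)).
      by apply: ler_wpM2r; [exact: prob_ge0|rewrite le_max lexx orbT].
    exact: ler_wpM2l.
  - move=> x Ox Bx; split; first exact: HE.
    move=> [n /=]; rewrite mem_index_iota => /andP[kn _]; apply: Bx.
    exact: leq_ltn_trans kn.
set Z := _ `\` _.
have mZ : measurable Z.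
  apply: measurableD; first exact: (event_Omega R).1.
  apply: bigcup_measurable => n /= Nn; apply: measurable_Bset.
  exact: leq_ltn_trans Nn.
have eZ : event Z by split=> // x [].
rewrite mu_prob //; congr (_%:E); apply/eqP; rewrite eq_le prob_ge0 andbT.
apply/ler_addgt0Pr => e e0; rewrite add0r.
have [r Hr] : exists r, q ^+ r <= e.
  have qn : `|q| < 1 by rewrite ger0_norm.
  have /cvgr0Pnorm_le /(_ e e0) [r _ /(_ r (leqnn r)) /= Hr] := cvg_expr qn.
  by exists r; exact: le_trans (ler_norm _) Hr.
have [k [E [_ aE PE HE]]] := H r.
apply: le_trans (le_trans PE Hr).
apply: prob_le => //; first exact: adapted_event aE.
move=> x [Ox nB]; apply: HE => // n Nn Bn; apply: nB.
by exists n.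
Qed.

End Divergence.

(** * Comparison of the weights with the series and of sums with products *)

Section Comparison.
Variable R : realType.

Lemma exp4_bracket (v : R) : 1 < v -> exists s, 4 ^+ s < v <= 4 ^+ s.+1.
Proof.
move=> v1; have ex : exists s, v <= 4 ^+ s.
  exists (Num.truncn v).+1; apply: le_trans (ltW (truncnS_gt v)) _.
  by rewrite -natrX ler_nat ltnW // ltn_expl.
case: (ex_minnP ex) => -[|s] vs smin; first by move: vs v1; rewrite expr0; lra.
exists s; rewrite vs andbT ltNge; apply/negP => /smin.
by rewrite ltnn.
Qed.

Lemma weight_ln_compare d : exists2 c : R, 0 < c & forall (v : R) s, 2 <= v ->
  4 ^+ s < v <= 4 ^+ s.+1 ->
  weight R d s.+1 <= c * (ln v ^+ d.-1 / v) /\ ln v ^+ d.-1 / v <= c * weight R d s.+1.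
Proof.
pose L : R := ln 2; have L0 : 0 < L by rewrite ln_gt0 // ltr1n.
have ln4 : ln 4 = 2 * L :> R.
  have -> : 4 = 2 * 2 :> R by rewrite -natrM.
  by rewrite lnM ?posrE // mulr_natl mulr2n.
(* With [L = ln 2], the bounds [s * 2L <= ln v] and [L <= ln v] give [(s + 2) * 2L <= 5 * ln v]; the
   second one, from [v >= 2], covers [s = 0]. The 4 in [c2] is the ratio of [4 ^+ s.+1] to
   [4 ^+ s]. *)
pose c1 := (5 / (2 * L)) ^+ d.-1; pose c2 := 4 * (2 * L) ^+ d.-1.
have c10 : 0 < c1 by rewrite exprn_gt0 // divr_gt0 // mulr_gt0.
have c20 : 0 < c2 by rewrite mulr_gt0 // exprn_gt0 // mulr_gt0.
exists (c1 + c2); first by rewrite addr_gt0.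
move=> v s v2 /andP[sv vs].
have v0 : 0 < v by lra.
have f0 (r : nat) : 0 < 4 ^+ r :> R by rewrite exprn_gt0.
have lnX (r : nat) : ln (4 ^+ r) = r%:R * (2 * L).
  by rewrite lnXn // ln4 [RHS]mulr_natl.
have Lv : L <= ln v by rewrite ler_ln ?posrE.
have lnv0 : 0 < ln v by lra.
have h1 : s%:R * (2 * L) <= ln v by rewrite -lnX ler_ln ?posrE // ltW.
have h2 : ln v <= s.+1%:R * (2 * L) by rewrite -lnX ler_ln ?posrE.
have A0 : 0 <= ln v ^+ d.-1 / v by rewrite divr_ge0 ?exprn_ge0 // ltW.
have W0 : 0 <= weight R d s.+1 by exact: weight_ge0.
split.
  apply: (@le_trans _ _ (c1 * (ln v ^+ d.-1 / v))); last first.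
    by apply: ler_wpM2r => //; rewrite lerDl ltW.
  rewrite /weight exprVn mulrA /c1 -exprMn; apply: ler_pM.
  - by rewrite exprn_ge0.
  - by rewrite invr_ge0 ltW.
  - apply: lerXn2r; rewrite ?nnegrE //.
      by rewrite mulr_ge0 ?(ltW lnv0) // divr_ge0 // ltW // mulr_gt0.
    rewrite mulrAC ler_pdivlMr ?mulr_gt0 // -2!natr1.
    by lra.
  - by rewrite lef_pV2 ?posrE.
apply: (@le_trans _ _ (c2 * weight R d s.+1)); last first.
  by apply: ler_wpM2r => //; rewrite lerDr ltW.
have -> : c2 * weight R d s.+1 = ((2 * L) * s.+2%:R) ^+ d.-1 * (4 ^+ s)^-1.
  rewrite /c2 /weight [(_ * s.+2%:R) ^+ _]exprMn [4^-1 ^+ s.+1]exprS exprVn.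
  by move: ((2 * L) ^+ d.-1) (s.+2%:R ^+ d.-1) (4 ^- s) => a b e; field.
apply: ler_pM.
- by rewrite exprn_ge0 // ltW.
- by rewrite invr_ge0 ltW.
- apply: lerXn2r; rewrite ?nnegrE ?(ltW lnv0) ?mulr_ge0 ?(ltW L0) //.
  apply: le_trans h2 _; rewrite mulrC; apply: ler_wpM2l; first by lra.
  by rewrite ler_nat.
- by rewrite lef_pV2 ?posrE // ltW.
Qed.

(** Absorbs the loss of [d] in [Aset_sub_Bset] into a constant. *)
Lemma weight_sub d s : weight R d (s - d) <= 4 ^+ d * weight R d s.
Proof.
rewrite /weight mulrCA; apply: ler_pM.
- by rewrite exprn_ge0.
- by rewrite exprn_ge0 // invr_ge0.
- by apply: lerXn2r; rewrite ?nnegrE // ler_nat ltnS leq_subr.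
rewrite !exprVn; have f0 (r : nat) : 0 < 4 ^+ r :> R by rewrite exprn_gt0.
rewrite ler_pdivlMr // mulrC ler_pdivrMr // -exprD.
by apply: ler_weXn2l; rewrite ?ler1n //; lia.
Qed.

Definition Aset d (Phi : nat -> R) n : set R :=
  [set x | Omega x /\ Phi n <= (\prod_(1 <= i < d.+1) cf_a (i * n) x)%:R].

Lemma adapted_Aset d (Phi : nat -> R) n : (0 < n)%N -> adapted (d * n) (Aset d Phi n).
Proof.
move=> n0; apply: (@adapted_cap R _ (@Omega R)
  [set x | Phi n <= (\prod_(1 <= i < d.+1) cf_a (i * n) x)%:R]).
  exact: adaptedT.
move=> x y xy /=; rewrite (eq_big_nat _ _ (F2 := fun i => cf_a (i * n) y)) //.
move=> i /andP[i1 id]; apply: xy; rewrite muln_gt0 i1 n0 /=.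
by rewrite leq_mul2r -ltnS id orbT.
Qed.

Lemma lgsum_multiples d n (x : R) :
  lgsum (multiples d n) x = (\sum_(1 <= i < d.+1) lg (i * n) x)%N.
Proof. by rewrite /lgsum /multiples big_map /index_iota subn1. Qed.

Lemma Bset_sub_Aset d (Phi : nat -> R) n s : (0 < n)%N -> Phi n <= 4 ^+ s ->
  @Bset R d n s `<=` Aset d Phi n.
Proof.
move=> n0 Ps x [Ox /= sx]; split=> //; apply: le_trans Ps _.
rewrite -natrX ler_nat; apply: (@leq_trans (4 ^ lgsum (multiples d n) x)).
  by rewrite leq_exp2l.
rewrite lgsum_multiples expn_sum big_nat [X in (_ <= X)%N]big_nat.
apply: leq_prod => i /andP[i1 _].
by rewrite -lg_ge // muln_gt0 i1.
Qed.

(** Each of the [d] factors is below [4 ^ (lg + 1)], so rounding the logarithms down loses at most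
    one unit per factor. *)
Lemma Aset_sub_Bset d (Phi : nat -> R) n s : (0 < d)%N -> (0 < n)%N -> 4 ^+ s < Phi n ->
  Aset d Phi n `<=` @Bset R d n (s.+1 - d).
Proof.
move=> d0 n0 sP x [Ox Px]; split=> //=.
have : (4 ^ s < 4 ^ (lgsum (multiples d n) x + d))%N.
  rewrite -(ltr_nat R) natrX; apply: lt_le_trans sP _; apply: le_trans Px _.
  rewrite ler_nat lgsum_multiples.
  have -> : (\sum_(1 <= i < d.+1) lg (i * n) x + d =
      \sum_(1 <= i < d.+1) (lg (i * n) x).+1)%N.
    rewrite [RHS](eq_bigr (fun i => lg (i * n) x + 1)%N) => [|i _]; last by rewrite addn1.
    by rewrite big_split /= sum_nat_const_nat muln1 subn1.
  rewrite expn_sum; apply: leq_prod => i _.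
  by rewrite ltnW // /lg trunc_log_ltn.
by rewrite ltn_exp2l // leq_subLR addnC.
Qed.

End Comparison.

(** * Measurability of [Lambda] and the two halves of the dichotomy *)

Lemma LambdaE (R : realType) d (Phi : nat -> R) : Lambda d Phi =
  [set x | Omega x /\ forall N, exists2 n, (N < n)%N & Aset d Phi n x].
Proof.
apply/seteqP; split=> x /=.
  move=> [x01 [xI H]]; split=> // N; have [n [Nn Hn]] := H N.
  by exists n.
move=> [[x01 xI] H]; split=> //; split=> // N; have [n Nn [_ Hn]] := H N.
by exists n.
Qed.

Lemma measurable_Lambda (R : realType) d (Phi : nat -> R) :
  measurable (Lambda d Phi).
Proof.
have -> : Lambda d Phi = @Omega R `&`
    \bigcap_N (\bigcup_(n in [set n | (N < n)%N]) Aset d Phi n).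
  rewrite LambdaE; apply/seteqP; split=> x /= [Ox H]; split=> // N.
    by move=> _; have [n Nn An] := H N; exists n.
  by have [n Nn An] := H N I; exists n.
apply: measurableI; first exact: (event_Omega R).1.
apply: bigcapT_measurable => N; apply: bigcup_measurable => n /= Nn.
apply: (measurable_adapted (@adapted_Aset _ _ _ _ _)).
exact: leq_ltn_trans Nn.
Qed.

Lemma Lambda_null (R : realType) (d : nat) (Phi : nat -> R) : (0 < d)%N ->
  (forall n, 2 <= Phi n) ->
  (\sum_(1 <= n <oo) ((ln (Phi n)) ^+ d.-1 / Phi n)%:E < +oo)%E ->
  (@lebesgue_measure R) (Lambda d Phi) = 0%E.
Proof.
move=> d0 hPhi hs.
have [c c0 Hc] := weight_ln_compare R d.
have t0 n : 0 <= ln (Phi n) ^+ d.-1 / Phi n.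
  have P2 := hPhi n; rewrite divr_ge0 ?exprn_ge0 ?ln_ge0 //; lra.
(* [lim_sup_set] runs over indices from 0 and the series from 1; the empty set at 0 reconciles
   them. *)
pose F n := if n is n'.+1 then Aset d Phi n'.+1 else set0.
have mF n : measurable (F n).
  case: n => [|n]; first exact: measurable0.
  exact: (measurable_adapted (@adapted_Aset _ _ _ _ _)).
have -> : Lambda d Phi = lim_sup_set F.
  rewrite LambdaE; apply/seteqP; split=> x.
    move=> [Ox H] N _; have [n Nn An] := H N; exists n => /=; first exact: ltnW.
    by case: n Nn An.
  move=> H; split.
    by have [n _] := H 0%N I; case: n => // n [].
  move=> N; have [n /= Nn Fn] := H N.+1 I; exists n => //.
  by case: n Nn Fn.
apply: lim_sup_set_cvg0 => //.
rewrite nneseries_recl //= measure0 add0e.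
(* The three factors come from [prob_Bset_le], [weight_sub] and [weight_ln_compare]. *)
pose C := 2 ^+ d * 4 ^+ d * c.
have C0 : 0 <= C by rewrite !mulr_ge0 ?exprn_ge0 // ltW.
apply: (@le_lt_trans _ _ (\sum_(1 <= n <oo) C%:E * ((ln (Phi n)) ^+ d.-1 / Phi n)%:E)%E).
  apply: lee_nneseries => // n _.
  case: n => [|n]; first by rewrite /= measure0 -EFinM lee_fin mulr_ge0.
  have aA : adapted (d * n.+1) (Aset d Phi n.+1) by exact: adapted_Aset.
  have [|s sP] := @exp4_bracket R (Phi n.+1); first by have := hPhi n.+1; lra.
  have [Hw _] := Hc _ _ (hPhi n.+1) sP.
  rewrite /= mu_prob; last exact: adapted_event aA.
  rewrite -EFinM lee_fin.
  have aB := @adapted_Bset R d n.+1 (s.+1 - d) _ (ltn0Sn n) (leqnn _).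
  apply: (@le_trans _ _ (prob (Bset d n.+1 (s.+1 - d)))).
    apply: prob_le; [exact: adapted_event aA|exact: adapted_event aB|].
    by apply: Aset_sub_Bset => //; case/andP: sP.
  have := prob_Bset_le d0 (s.+1 - d) (adaptedT R 0) (ltn0Sn n).
  rewrite setIidr; last exact: aB.1.
  move=> h; apply: le_trans h _; rewrite /prob mu_Omega mulr1.
  rewrite /C -!mulrA; apply: ler_wpM2l; first by rewrite exprn_ge0.
  apply: le_trans (weight_sub R d s.+1) _.
  by apply: ler_wpM2l => //; rewrite exprn_ge0.
rewrite nneseriesZl; first exact: lte_mul_pinfty.
by move=> n _; rewrite lee_fin.
Qed.

Lemma Lambda_full (R : realType) (d : nat) (Phi : nat -> R) : (0 < d)%N ->
  (forall n, 2 <= Phi n) ->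
  (\sum_(1 <= n <oo) ((ln (Phi n)) ^+ d.-1 / Phi n)%:E = +oo)%E ->
  (@lebesgue_measure R) (Lambda d Phi) = 1%E.
Proof.
move=> d0 hPhi hs.
have [c c0 Hc] := weight_ln_compare R d.
pose u n : R := ln (Phi n) ^+ d.-1 / Phi n.
have u0 n : 0 <= u n.
  have P2 := hPhi n; rewrite divr_ge0 ?exprn_ge0 ?ln_ge0 //; lra.
have /choice[s Hs] : forall n, exists s, 4 ^+ s < Phi n <= 4 ^+ s.+1.
  by move=> n; apply: exp4_bracket; have := hPhi n; lra.
(* If the weights beyond [k] had sums bounded by [M], adding the first [k] weights and comparing
   termwise would bound the partial sums of the series. *)
have wdiv k (M : R) : exists N, M <= \sum_(k.+1 <= n < N) weight R d (s n).+1.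
  apply: contrapT => /forallNP H.
  have w0 n : 0 <= weight R d (s n).+1 by exact: weight_ge0.
  suff : (\sum_(1 <= n <oo) (u n)%:E <= (c * (\sum_(1 <= n < k.+1) weight R d (s n).+1 + M))%:E)%E.
    by rewrite hs leye_eq.
  apply: lime_le; first by apply: is_cvg_nneseries => n _ _; rewrite lee_fin.
  apply: nearW => N; rewrite sumEFin lee_fin.
  apply: (@le_trans _ _ (c * \sum_(1 <= n < N) weight R d (s n).+1)).
    rewrite big_distrr /=; apply: ler_sum => n _.
    by have [_] := Hc _ _ (hPhi n) (Hs n).
  rewrite ler_pM2l //.
  have HM := H (maxn k.+1 N).
  apply: (@le_trans _ _ (\sum_(1 <= n < maxn k.+1 N) weight R d (s n).+1)).
    have [N1|N1] := leqP N 1; first by rewrite big_geq // sumr_ge0.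
    rewrite (@big_cat_nat _ _ _ N 1 (maxn k.+1 N)) //=; [|exact: ltnW|exact: leq_maxr].
    by rewrite lerDl sumr_ge0.
  rewrite (@big_cat_nat _ _ _ k.+1 1 (maxn k.+1 N)) //=; last exact: leq_maxl.
  by rewrite lerD2l leNgt; apply/negP => /ltW.
have mO : measurable (@Omega R) by exact: (event_Omega R).1.
have mL := measurable_Lambda d Phi.
have LO : Lambda d Phi `<=` @Omega R by rewrite LambdaE => x [].
have : (@lebesgue_measure R) (@Omega R) =
    ((@lebesgue_measure R) (@Omega R `\` Lambda d Phi) +
     (@lebesgue_measure R) (@Omega R `&` Lambda d Phi))%E by exact: measureDI.
rewrite mu_Omega (setIidr LO).
suff -> : (@lebesgue_measure R) (@Omega R `\` Lambda d Phi) = 0%E.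
  by rewrite add0e.
(* A point of [Omega] outside [Lambda] avoids all [Aset] beyond some [N], hence all the smaller
   [Bset]; so it lies in one of the countably many sets [Z N], which are null by [avoid_null]. *)
pose Z N := @Omega R `\`
  \bigcup_(n in [set n | (N < n)%N]) (@Bset R d n (s n).+1).
have mZ N : measurable (Z N).
  apply: measurableD => //; apply: bigcup_measurable => n /= Nn.
  by apply: measurable_Bset; exact: leq_ltn_trans Nn.
apply/eqP; rewrite eq_le measure_ge0 andbT.
apply: (@le_trans _ _ (\sum_(N <oo) lebesgue_measure (Z N))%E); last first.
  by rewrite eseries0 // => N _ _; exact: (avoid_null d0 wdiv).
apply: measure_sigma_subadditive => //; first exact: measurableD.
rewrite LambdaE => x [Ox nL].
apply: contrapT => nZ; apply: nL; split=> // N.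
apply: contrapT => nA; apply: nZ; exists N => //; split=> // -[n /= Nn Bn].
apply: nA; exists n => //; apply: Bset_sub_Aset Bn; first exact: leq_ltn_trans Nn.
by case/andP: (Hs n).
Qed.

Theorem theorem1p4 (R : realType) (d : nat) (Phi : nat -> R)
  (hd : (1 <= d)%N) (hPhi : forall n : nat, (1 <= n)%N -> 2 <= Phi n) :
  ((\sum_(1 <= n <oo) ((ln (Phi n)) ^+ d.-1 / Phi n)%:E < +oo)%E ->
      (@lebesgue_measure R) (Lambda d Phi) = 0%E) /\
  ((\sum_(1 <= n <oo) ((ln (Phi n)) ^+ d.-1 / Phi n)%:E = +oo)%E ->
      (@lebesgue_measure R) (Lambda d Phi) = 1%E).
Proof.
(* [Phi 0] is unconstrained, but neither the series nor [Lambda] depends on it. *)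
pose Psi n := if n == 0%N then 2 else Phi n.
have hPsi n : 2 <= Psi n.
  by rewrite /Psi; case: eqP => // /eqP; rewrite -lt0n => /hPhi.
have -> : Lambda d Phi = Lambda d Psi.
  apply/seteqP; split=> x [x01 [xI H]]; split=> //; split=> // N;
    have [n [Nn Hn]] := H N; exists n; split=> //; move: Hn;
    by rewrite /Psi gtn_eqF //; exact: leq_ltn_trans Nn.
have -> : (\sum_(1 <= n <oo) ((ln (Phi n)) ^+ d.-1 / Phi n)%:E =
           \sum_(1 <= n <oo) ((ln (Psi n)) ^+ d.-1 / Psi n)%:E)%E.
  apply: congr_lim; apply/funext => N; apply: eq_big_nat => n /andP[n1 _].
  by rewrite /Psi gtn_eqF.
by split; [exact: Lambda_null|exact: Lambda_full].
Qed.
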